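(* Let $G$ be a group and $E$ a finite group. (1) There is a central extension $1\to C\to G\to E\to1$ if and only if $G$ fits into a pull-back diagram $$\begin{array}{ccc}G&\to&E\\ \downarrow&&\downarrow\\ C&\to&C_m\end{array}$$ (2) There is a non-central extension $1\to C\to G\to E\to1$ if and only if $G$ fits into a pull-back diagram $$\begin{array}{ccc}G&\to&E\\ \downarrow&&\downarrow\\ D&\to&D_m\end{array}$$
   Context: $C$ is the infinite cyclic group, $C_m$ the cyclic group of order $m$, $D=\langle S,T\mid S^2=(ST)^2=1\rangle$ the infinite dihedral group, $D_m=\langle\sigma,\tau\mid\sigma^2=(\sigma\tau)^2=\tau^m=1\rangle$ the dihedral group of order $2m$. An extension $1\to C\to G\to E\to1$ (a short exact sequence of groups and homomorphisms) is central if the image of $C$ is central in $G$, and non-central otherwise. ''$G$ fits into a pull-back diagram'' means that, for some $m\ge1$ and some homomorphism $E\to C_m$ (respectively $E\to D_m$), $G$ is isomorphic to the corresponding fibre product, where the bottom arrow $C\to C_m$ (respectively $D\to D_m$, $S\mapsto\sigma$, $T\mapsto\tau$) is the canonical projection.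
   Formalization: In (2) the homomorphism E→D_m is required to send some element of E to a reflection (not a power of τ); otherwise the ''if'' fails, e.g. E=1, m=1 gives G≅C, which has no non-central extension. G carries a choice structure, which is classically automatic. *)

(* Defs.v *)
From HB Require Import structures.
From mathcomp Require Import all_boot ssralg ssrint zmodp fingroup.

Set Implicit Arguments.
Unset Strict Implicit.
Unset Printing Implicit Defensive.

Import GRing.Theory.
Local Open Scope group_scope.

(* A groupType may be infinite.  The choice structure that it carries is no
   restriction: classically, every type has one. *)

Notation ghom := UMagmaMorphism.type.

Definition isomorphic (G H : groupType) : Prop :=
  exists f : ghom G H, bijective f.

(* 1 -> A -> G -> Q -> 1 *)
Definition short_exact (A G Q : groupType)
    (i : ghom A G) (p : ghom G Q) : Prop :=
  [/\ injective i, (forall q : Q, exists g : G, p g = q) &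
      forall g : G, p g = 1 <-> exists a : A, i a = g].

Definition central_image (A G : groupType) (i : ghom A G) : Prop :=
  forall (a : A) (g : G), commute (i a) g.

Section FibreProduct.
Variables (X Y Z : groupType).
Variables (p : ghom X Z) (q : ghom Y Z).

Definition fibre_pred : pred (X * Y) := fun u => p u.1 == q u.2.

Definition fibre_product : Type := {u : X * Y | fibre_pred u}.

Lemma fibre_group_closed : group_closed fibre_pred.
Proof.
split=> [|u v]; rewrite !unfold_in /fibre_pred /=; first by rewrite !gmulf1.
by move=> /eqP uE /eqP vE; rewrite !gmulfM !gmulfV uE vE.
Qed.

HB.instance Definition _ := [isSub of fibre_product for sval].
HB.instance Definition _ := [Choice of fibre_product by <:].
HB.instance Definition _ :=
  SubChoice_isSubGroup.Build (X * Y)%type fibre_pred fibre_product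
    fibre_group_closed.

End FibreProduct.

Definition Cinf : groupType := GRing.to_multiplicative int.

(* The cyclic group of order m, for m >= 1 only: m.-1.+1 = m then.
   ('Z_m would be of order 2 for m = 1.) *)
Definition Cyc (m : nat) : groupType := GRing.to_multiplicative 'I_m.-1.+1.

(* Reduction modulo m, sending the generator 1 to the class of 1 *)
Definition Zmod (m : nat) (n : int) : 'I_m.-1.+1 := (Zp1 *~ n)%R.

Definition Cproj (m : nat) : Cinf -> Cyc m := Zmod m.

Lemma Cproj_morph m : monoid.monoid_morphism (Cproj m).
Proof. by split=> [//|x y]; apply: mulrzDr. Qed.

HB.instance Definition _ m :=
  isUMagmaMorphism.Build Cinf (Cyc m) (Cproj m) (@Cproj_morph m).

(* The semidirect product of V by the group of order 2 acting by inversion: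
   (a, b) stands for T^a S^b. *)
Definition dih (V : zmodType) : Type := (V * bool)%type.

Section Dih.
Variable V : zmodType.
Local Open Scope ring_scope.

HB.instance Definition _ := Choice.on (dih V).

Definition dih_mul (x y : dih V) : dih V :=
  (x.1 + (if x.2 then - y.1 else y.1), x.2 (+) y.2).
Definition dih_one : dih V := (0, false).
Definition dih_inv (x : dih V) : dih V :=
  (if x.2 then x.1 else - x.1, x.2).

Lemma dih_mulA : associative dih_mul.
Proof.
move=> [a [|]] [b [|]] [c s]; congr pair; rewrite /= ?opprD ?opprK ?addrA //.
by rewrite negbK.
Qed.

Lemma dih_mul1 : left_id dih_one dih_mul.
Proof. by move=> [a s]; rewrite /dih_mul /= add0r. Qed.

Lemma dih_mulr1 : right_id dih_one dih_mul.
Proof. by move=> [a [|]]; rewrite /dih_mul /= ?oppr0 addr0. Qed.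

Lemma dih_mulV : left_inverse dih_one dih_inv dih_mul.
Proof. by move=> [a [|]]; rewrite /dih_mul /= ?subrr ?addNr. Qed.

Lemma dih_mulrV : right_inverse dih_one dih_inv dih_mul.
Proof. by move=> [a [|]]; rewrite /dih_mul /= ?subrr. Qed.

HB.instance Definition _ := isGroup.Build (dih V)
  dih_mulA dih_mul1 dih_mulr1 dih_mulV dih_mulrV.

End Dih.

Definition Dinf : groupType := dih int.

(* The dihedral group of order 2m, for m >= 1 only *)
Definition Dih (m : nat) : groupType := dih 'I_m.-1.+1.

Definition dS : Dinf := (0%R, true).
Definition dT : Dinf := (1%R, false).
Definition dsigma (m : nat) : Dih m := (0%R, true).
Definition dtau (m : nat) : Dih m := (Zp1, false).

Definition Dproj (m : nat) (x : Dinf) : Dih m := (Zmod m x.1, x.2).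

Lemma Dproj_morph m : monoid.monoid_morphism (Dproj m).
Proof.
split=> // [] [a s] [b t]; congr pair; rewrite /Zmod /=.
by case: s; rewrite mulrzDr ?mulrNz.
Qed.

HB.instance Definition _ m :=
  isUMagmaMorphism.Build Dinf (Dih m) (Dproj m) (@Dproj_morph m).

Lemma DprojS m : Dproj m dS = dsigma m.
Proof. by []. Qed.

Lemma DprojT m : Dproj m dT = dtau m.
Proof. by rewrite /Dproj /Zmod /= mulr1z. Qed.

(* Some f e is a reflection, i.e. not a rotation.  When every f e is a rotation,
   the fibre product of Dproj m and f is a central extension: with E trivial it
   is infinite cyclic, and it is then not a non-central extension of E. *)
Definition meets_reflections (m : nat) (E : groupType) (f : ghom E (Dih m)) :
    Prop :=
  exists e : E, forall k : nat, f e <> dtau m ^+ k.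

(* The dihedral groups above have the presentations
     < S, T | S^2 = (ST)^2 = 1 >  and
     < sigma, tau | sigma^2 = (sigma tau)^2 = tau^m = 1 >:
   the generators satisfy the relations, and are universal for them. *)

Lemma Dinf_relations : dS ^+ 2 = 1 /\ (dS * dT) ^+ 2 = 1.
Proof. by []. Qed.

Lemma Dih_relations m : 0 < m ->
  [/\ dsigma m ^+ 2 = 1, (dsigma m * dtau m) ^+ 2 = 1 & dtau m ^+ m = 1].
Proof.
case: m => // m _; split.
- by rewrite expg2; congr pair; rewrite /= oppr0 addr0.
- by rewrite expg2; congr pair; rewrite /= add0r opprK addNr.
have E k : dtau m.+1 ^+ k = (Zp1 *+ k, false)%R.
  elim: k => [//|k IHk]; rewrite expgS IHk.
  by congr pair; rewrite /= -mulrS.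
by rewrite E Zp_mulrn; congr pair; apply: val_inj; rewrite /= modnMl.
Qed.

Section Universal.
Variables (H : groupType) (s t : H).
Hypotheses (s2 : s ^+ 2 = 1) (st2 : (s * t) ^+ 2 = 1).

Let zpow (n : int) : H :=
  match n with Posz k => t ^+ k | Negz k => t ^- k.+1 end.

Let zpowE (a b : nat) : zpow (a%:Z - b%:Z)%R = t ^+ a * t ^- b.
Proof.
have zpowN n : zpow (- n%:Z)%R = t ^- n by case: n => [|n]; rewrite ?invg1.
have [le_ba|/ltnW le_ab] := leqP b a; first by rewrite subzn //= expgnFr.
by rewrite -opprB subzn // zpowN expgnFr // invgF.
Qed.

Let zpowP (n : int) : exists a b : nat, n = (a%:Z - b%:Z)%R.
Proof.
by case: n => k; [exists k, 0 | exists 0, k.+1]; rewrite ?subr0 ?sub0r ?NegzE.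
Qed.

Let comm_tt (a b : nat) : commute (t ^+ a) (t ^- b).
Proof. exact/commuteV/commuteX2. Qed.

Let zpowD (m n : int) : zpow (m + n)%R = zpow m * zpow n.
Proof.
have [a [b ->]] := zpowP m; have [c [d ->]] := zpowP n.
rewrite addrACA -opprD -!PoszD !zpowE !expgnDr invgM.
rewrite -!mulgA; congr (_ * _); rewrite [RHS]mulgA -comm_tt -mulgA.
by congr (_ * _); rewrite -!invgM -!expgnDr addnC.
Qed.

Let st_conj : s * t = t^-1 * s.
Proof.
apply: (mulgI t); rewrite mulVKg; apply: (mulgI s).
by rewrite mulgA -!expg2 st2 s2.
Qed.

Let st_expn k : s * t ^+ k = t ^- k * s.
Proof.
elim: k => [|k IHk]; first by rewrite expg0 invg1 mulg1 mul1g.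
by rewrite [in LHS]expgSr mulgA IHk -mulgA st_conj mulgA -invgM expgS.
Qed.

Let st_expnN k : s * t ^- k = t ^+ k * s.
Proof.
by apply: (mulgI (t ^- k)); rewrite mulKg mulgA -st_expn mulgK.
Qed.

Let st_zpow n : s * zpow n = zpow (- n)%R * s.
Proof.
have [a [b ->]] := zpowP n; rewrite opprB !zpowE mulgA st_expn -mulgA st_expnN.
by rewrite mulgA comm_tt.
Qed.

Lemma Dinf_universal :
  exists f : ghom Dinf H, [/\ f dS = s, f dT = t &
    forall g : ghom Dinf H, g dS = s -> g dT = t -> g =1 f].
Proof.
pose f (x : Dinf) : H := zpow x.1 * s ^+ x.2.
have fM : monoid.monoid_morphism f.
  split=> [|[a b] [c d]]; first by rewrite /f /= mulg1.
  rewrite /f /= zpowD -!mulgA; congr (_ * _).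
  case: b => /=; last by rewrite mul1g.
  rewrite mulgA [s ^+ 1 * _]st_zpow -mulgA; congr (_ * _).
  by case: d; rewrite /= ?mulg1 // -expg2 s2.
pose fH := isUMagmaMorphism.Build Dinf H f fM.
pose F : ghom Dinf H := HB.pack f fH.
exists F; split=> [||g gS gT [a b]]; rewrite /= /f /= ?mul1g ?mulg1 //.
have -> : ((a, b) : Dinf) = ((a, false) : Dinf) * dS ^+ b.
  by case: b; congr pair; rewrite /= addr0.
have gN (k : nat) : g (Posz k, false) = t ^+ k.
  rewrite -gT -gmulfXn; congr (g _); elim: k => [//|k IHk].
  by rewrite expgS -IHk; congr pair; rewrite /= -PoszD.
rewrite gmulfM gmulfXn gS; congr (_ * _).
case: a => k; first exact: gN.
by rewrite /= -gN -gmulfV; congr (g _).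
Qed.

Lemma Dih_universal m : 0 < m -> t ^+ m = 1 ->
  exists f : ghom (Dih m) H, [/\ f (dsigma m) = s, f (dtau m) = t &
    forall g : ghom (Dih m) H, g (dsigma m) = s -> g (dtau m) = t -> g =1 f].
Proof.
case: m => // m _ tm.
have t_mod k : t ^+ (k %% m.+1) = t ^+ k.
  by rewrite [in RHS](divn_eq k m.+1) expgnDr mulnC expgnA tm expg1n mul1g.
pose f (x : Dih m.+1) : H := t ^+ (x.1 : 'I_m.+1) * s ^+ x.2.
have fM : monoid.monoid_morphism f.
  split=> [|[a b] [c d]]; first by rewrite /f /= mulg1.
  rewrite /f /= t_mod expgnDr -!mulgA; congr (_ * _).
  case: b => /=; last by rewrite mul1g.
  rewrite t_mod expgnFr ?tm ?mul1g; last exact: ltnW.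
  rewrite mulgA [s ^+ 1 * _]st_expn -mulgA; congr (_ * _).
  by case: d; rewrite /= ?mulg1 // -expg2 s2.
pose fH := isUMagmaMorphism.Build (Dih m.+1) H f fM.
pose F : ghom (Dih m.+1) H := HB.pack f fH.
exists F; split=> [||g gS gT [a b]]; rewrite /= /f /= ?mul1g ?mulg1 ?t_mod //.
have tauE k : dtau m.+1 ^+ k = (Zp1 *+ k, false)%R.
  elim: k => [//|k IHk]; rewrite expgS IHk.
  by congr pair; rewrite /= -mulrS.
have -> : ((a, b) : Dih m.+1) = dtau m.+1 ^+ a * dsigma m.+1 ^+ b.
  have -> : dtau m.+1 ^+ a = (a, false).
    rewrite tauE Zp_mulrn; congr pair; apply: val_inj.
    by rewrite /= modnMml mul1n modZp.
  by case: b; congr pair; rewrite /= addr0.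
by rewrite gmulfM !gmulfXn gS gT.
Qed.

End Universal.

(* Main.v *)
(** Fix a section s of p : G -> E.  Conjugation by g acts on the kernel C by a
    sign, and g s(e) = i(c(g,e)) s(p(g)e) defines integers c(g,e).  Their sum
    over e in E is the transfer r, twisted by the sign: it is a crossed
    homomorphism G -> C which is multiplication by m = |E| on C.  Hence r, or r
    paired with the sign, is a homomorphism from G to C, or to D, which maps the
    kernel of p isomorphically onto that of C -> C_m, or D -> D_m.  A square of
    groups with surjective rows is a pull-back exactly when it induces an
    isomorphism between the kernels of its rows. *)
Require Import Defs.
From HB Require Import structures.
From mathcomp Require Import all_boot ssralg ssrint zmodp fingroup.

Set Implicit Arguments.
Unset Strict Implicit.
Unset Printing Implicit Defensive.

Import GRing.Theory.
Local Open Scope group_scope.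

Lemma inj_surj_bij (T : choiceType) (U : eqType) (f : T -> U) :
  injective f -> (forall u, exists t, f t = u) -> bijective f.
Proof.
move=> f_inj f_surj.
have f_surjb u : exists t, f t == u by have [t <-] := f_surj u; exists t.
exists (fun u => xchoose (f_surjb u)) => [t|u]; last first.
  exact/eqP/(xchooseP (f_surjb u)).
by apply: f_inj; apply/eqP/(xchooseP (f_surjb (f t))).
Qed.

Lemma mulVg1_eq (G : groupType) (x y : G) : x^-1 * y = 1 -> x = y.
Proof. by move=> /mulg1_eq; rewrite invgK. Qed.

(** * Pull-back squares and the kernels of their rows *)

Section Pullback.
Variables (A X Z G E : groupType).
Variables (j : ghom A X) (q : ghom X Z).
Hypotheses (j_inj : injective j)
  (ker_q : forall x, q x = 1 <-> exists a, j a = x).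

(** As [rho] maps the kernel of [p] onto that of [q], [q \o rho] descends along [p] to [f]; the
    isomorphism is [(rho, p)]. *)
Lemma fibre_product_of_extension (i : ghom A G) (p : ghom G E)
    (rho : ghom G X) :
  short_exact i p -> (forall a, rho (i a) = j a) ->
  exists f : ghom E Z,
    (forall g, f (p g) = q (rho g)) /\ isomorphic G (fibre_product q f).
Proof.
move=> [i_inj p_surj ker_p] rho_i.
have p_surjb e : exists g, p g == e by have [g <-] := p_surj e; exists g.
pose s e := xchoose (p_surjb e).
have sK e : p (s e) = e by apply/eqP/(xchooseP (p_surjb e)).
pose f e := q (rho (s e)).
have fp g : f (p g) = q (rho g).
  apply: mulVg1_eq; rewrite /f -!gmulfV -!gmulfM; apply/ker_q.
  have /ker_p[a <-] : p ((s (p g))^-1 * g) = 1.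
    by rewrite gmulfM gmulfV sK mulVg.
  by exists a; rewrite rho_i.
have fM : monoid.monoid_morphism f.
  split=> [|x y]; first by rewrite -(@gmulf1 _ _ p) fp !gmulf1.
  by rewrite -[in LHS](sK x) -[in LHS](sK y) -gmulfM fp !gmulfM.
pose fH := isUMagmaMorphism.Build E Z f fM.
pose F : ghom E Z := HB.pack f fH.
exists F; split=> //.
have phiP g : fibre_pred q F (rho g, p g) by apply/eqP; rewrite /= fp.
pose phi g : fibre_product q F := exist _ (rho g, p g) (phiP g).
have phiM : monoid.monoid_morphism phi.
  split=> [|x y]; apply: val_inj; rewrite /= ?gmulf1 //.
  by rewrite !gmulfM.
pose phiH := isUMagmaMorphism.Build G (fibre_product q F) phi phiM.
pose Phi : ghom G (fibre_product q F) := HB.pack phi phiH.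
exists Phi; apply: inj_surj_bij => [g h /(congr1 val)[rhoE pE]|[[x e] xe]].
  (* Elements with the same image differ by some [i a], and [rho (i a) = j a] forces [a = 1]. *)
  have /ker_p[a aE] : p (g^-1 * h) = 1 by rewrite gmulfM gmulfV pE mulVg.
  apply: mulVg1_eq; rewrite -aE.
  suff -> : a = 1 by rewrite gmulf1.
  by apply: j_inj; rewrite -rho_i aE gmulfM gmulfV rhoE mulVg gmulf1.
have /= /eqP qx := xe.
(* [s e] lies over [e]; [rho (s e)] is off from [x] by some [j a], which the factor [i a]
   corrects. *)
have /ker_q[a aE] : q ((rho (s e))^-1 * x) = 1.
  by rewrite gmulfM gmulfV qx mulVg.
exists (s e * i a); apply: val_inj; rewrite /= !gmulfM rho_i aE mulVKg sK.
suff -> : p (i a) = 1 by rewrite mulg1.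
by apply/ker_p; exists a.
Qed.

(** The kernel of the projection to [E] consists of the pairs [(j a, 1)]; centrality tests them only
    against those [x] that occur in the fibre product. *)
Lemma extension_of_fibre_product (f : ghom E Z) :
  (forall z, exists x, q x = z) -> isomorphic G (fibre_product q f) ->
  exists (i : ghom A G) (p : ghom G E), short_exact i p /\
    (central_image i <-> forall a x e, q x = f e -> commute (j a) x).
Proof.
move=> q_surj [phi [psi phiK psiK]].
have phi_inj := can_inj phiK.
have kP a : fibre_pred q f (j a, 1).
  by apply/eqP; rewrite /= gmulf1; apply/ker_q; exists a.
pose k a : fibre_product q f := exist _ (j a, 1) (kP a).
have iM : monoid.monoid_morphism (psi \o k).
  split=> [|a b]; apply: phi_inj; rewrite ?gmulfM /= !psiK ?gmulf1;
    apply: val_inj; rewrite /= ?gmulf1 //.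
  by rewrite gmulfM; congr pair; rewrite /= mulg1.
pose iH := isUMagmaMorphism.Build A G (psi \o k) iM.
pose i : ghom A G := HB.pack (psi \o k) iH.
have pM : monoid.monoid_morphism (fun g => (val (phi g)).2).
  by split=> [|g h]; rewrite ?gmulf1 ?gmulfM.
pose pH := isUMagmaMorphism.Build G E (fun g => (val (phi g)).2) pM.
pose p : ghom G E := HB.pack (fun g => (val (phi g)).2) pH.
exists i, p; split; first split.
- by move=> a b /= /(can_inj psiK) /(congr1 val)[/j_inj].
- move=> e; have [x qx] := q_surj (f e).
  have xP : fibre_pred q f (x, e) by apply/eqP.
  by exists (psi (exist _ (x, e) xP)); rewrite /= psiK.
- move=> g; split=> [/= pg|[a <-]]; last by rewrite /= psiK.
  have := valP (phi g); rewrite /fibre_pred /= pg gmulf1 => /eqP/ker_q[a aE].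
  exists a; rewrite /= -[RHS]phiK; congr psi; apply: val_inj => /=.
  by rewrite aE -[in LHS]pg; case: (sval _).
split=> [ci a x e qx|cj a g].
  have xP : fibre_pred q f (x, e) by apply/eqP.
  have /(congr1 phi) := ci a (psi (exist _ (x, e) xP)).
  by rewrite !gmulfM /= !psiK => /(congr1 val)[].
apply: phi_inj; rewrite !gmulfM /= psiK; apply: val_inj => /=.
have := valP (phi g); rewrite /fibre_pred /=; case: (sval _) => x e /= /eqP qx.
by congr pair; [apply: cj qx | rewrite /= mul1g mulg1].
Qed.

End Pullback.

(** * The sign of the conjugation action and the twisted transfer *)

Section Transfer.
Variables (G : groupType) (E : finGroupType).
Variables (i : ghom Cinf G) (p : ghom G E).
Hypothesis exact_ip : short_exact i p.

Let iD (a b : int) : i (a + b)%R = i a * i b.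
Proof. exact: (@gmulfM _ _ i). Qed.

Let iN (a : int) : i (- a)%R = (i a)^-1.
Proof. exact: (gmulfV i). Qed.

Let i0 : i 0%R = 1.
Proof. exact: (@gmulf1 _ _ i). Qed.

(** Conjugation by [g] and by [g^-1] multiplies the kernel by integers with product 1, so both are 1
    or both are -1; [eps g] is true for -1. *)
Lemma kernel_conj_sign : exists eps : G -> bool,
  [/\ forall g (a : int), g * i a = i (if eps g then - a else a)%R * g,
      forall g h, eps (g * h) = eps g (+) eps h &
      central_image i <-> forall g, eps g = false].
Proof.
have [i_inj _ ker_p] := exact_ip.
have conj_i g : exists n : int, forall a : int, g * i a = i (n * a)%R * g.
  have /ker_p[n nE] : p (g * i 1%R * g^-1) = 1.
    have /ker_p pi : exists a, i a = i 1%R by exists 1%R.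
    by rewrite !gmulfM pi mulg1 gmulfV mulgV.
  exists n; have nE1 : g * i 1%R = i n * g by rewrite nE mulgKV.
  have nE1V : g * i (-1)%R = i (- n)%R * g.
    by rewrite !iN; apply: (mulgI (i n)); rewrite mulVKg mulgA -nE1 mulgK.
  elim/int_rect=> [|k IHk|k IHk]; first by rewrite mulr0 i0 mulg1 mul1g.
    by rewrite -addn1 PoszD mulrDr mulr1 !iD mulgA IHk -mulgA nE1 mulgA.
  rewrite -addn1 PoszD opprD mulrDr mulrN1 !iD mulgA IHk -mulgA nE1V.
  by rewrite mulgA.
have signP g : exists b : bool, forall a : int,
    g * i a = i (if b then - a else a)%R * g.
  have [n nP] := conj_i g; have [n' n'P] := conj_i g^-1.
  have n'n : (n' * n = 1)%R.
    apply: i_inj; apply: (mulIg g^-1); rewrite -[n in (n' * n)%R]mulr1 -n'P.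
    by apply: (mulIg g); rewrite -mulgA -nP mulKg mulgKV.
  by have /orP[] := intUnitRing.unitzPl n'n => /eqP n1;
    [exists false|exists true] => a; rewrite nP n1 ?mul1r ?mulN1r.
(* The sign is read off on the generator, since 1 and -1 differ in [int]. *)
pose eps g := g * i 1%R != i 1%R * g.
have epsP g (a : int) : g * i a = i (if eps g then - a else a)%R * g.
  have [[] bP] := signP g; rewrite bP /eps bP; last by rewrite eqxx.
  by rewrite (inj_eq (mulIg g)) (inj_eq i_inj).
exists eps; split=> // [g h|]; last first.
  split=> [ci g|eps0 a g]; first by apply/negbF/eqP; rewrite ci.
  by rewrite /commute epsP eps0.
(* Moving [g * h] past [i 1] at once or one factor at a time gives the same sign. *)
have := epsP (g * h) 1%R; rewrite -mulgA epsP mulgA epsP -mulgA.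
move/mulIg/i_inj; by do 3!case: (eps _).
Qed.

Lemma twisted_transfer (eps : G -> bool) :
  (forall g (a : int), g * i a = i (if eps g then - a else a)%R * g) ->
  exists r : G -> int,
    (forall g h, r (g * h)%g = r g + (if eps g then - r h else r h))%R /\
    (forall a : int, r (i a) = a *~ #|E|)%R.
Proof.
move=> epsP; have [i_inj p_surj ker_p] := exact_ip.
have p_surjb e : exists g, p g == e by have [g <-] := p_surj e; exists g.
pose s e := xchoose (p_surjb e).
have sK e : p (s e) = e by apply/eqP/(xchooseP (p_surjb e)).
have c_ex g e : exists a : int, g * s e == i a * s (p g * e).
  have /ker_p[a aE] : p (g * s e * (s (p g * e))^-1) = 1.
    by rewrite !gmulfM gmulfV !sK mulgV.
  by exists a; rewrite aE mulgKV.
pose c (g : G) (e : E) : int := xchoose (c_ex g e).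
have cP g e : g * s e = i (c g e) * s (p g * e).
  by apply/eqP/(xchooseP (c_ex g e)).
(* When [g * h * s e] is expanded in two stages, [i (c h e)] has to pass [g], which brings in the
   sign. *)
have cM g h e : c (g * h) e =
    ((if eps g then - c h e else c h e) + c g (p h * e)%g)%R.
  apply: i_inj; apply: (mulIg (s (p (g * h) * e))).
  rewrite -cP iD -mulgA (cP h) mulgA (epsP g (c h e)) -!mulgA; congr (_ * _).
  by rewrite cP gmulfM mulgA.
exists (fun g => \sum_(e : E) c g e)%R; split=> [g h|a].
  rewrite (eq_bigr _ (fun e _ => cM g h e)) big_split /= addrC; congr (_ + _)%R.
    (* Left translation by [p h] permutes [E]. *)
    by rewrite [RHS](reindex_inj (mulgI (p h))).
  by case: (eps g); rewrite // sumrN.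
(* [i a] acts trivially on [E], so each of the [#|E|] terms equals [a]. *)
have pi : p (i a) = 1 by apply/ker_p; exists a.
rewrite (eq_bigr (fun=> a)) => [|e _]; first by rewrite sumr_const.
by apply: i_inj; apply: (mulIg (s e)); rewrite -{2}[e]mul1g -pi -cP.
Qed.

End Transfer.

(** * Kernels of the reductions modulo m of C and D *)

Lemma Zmod_eq0 (m : nat) (n : int) : 0 < m ->
  Zmod m n = 0%R <-> exists a : int, (a *~ m)%R = n.
Proof.
case: m => // m _; have Zmod_nat (k : nat) : Zmod m.+1 k = inZp k.
  by apply: val_inj; rewrite /Zmod /= -pmulrn Zp_mulrn /= modnMml mul1n.
have nat_dvd (k : nat) : Zmod m.+1 k = 0%R -> exists a : int, (a *~ m.+1)%R = k.
  rewrite Zmod_nat => /(congr1 val) /= /eqP/dvdnP[a ->].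
  by exists a; rewrite PoszM mulrzz.
split=> [|[a <-]].
  case: n => k; first exact: nat_dvd.
  rewrite NegzE /Zmod mulrNz => /eqP; rewrite oppr_eq0 => /eqP/nat_dvd[a aE].
  by exists (- a)%R; rewrite mulNrz aE.
rewrite /Zmod mulrzz mulrzA -pmulrn Zp_mulrn.
by apply: val_inj; rewrite /= modnMl.
Qed.

Lemma Zmod_surj (m : nat) (z : 'I_m.-1.+1) : exists n : int, Zmod m n = z.
Proof.
exists (z : nat); apply: val_inj; rewrite /Zmod -pmulrn Zp_mulrn /=.
by rewrite modnMml mul1n modn_small.
Qed.

Lemma mulrz_nat_inj (m : nat) : 0 < m -> injective (fun a : int => a *~ m)%R.
Proof. by case: m => // m _ a b /=; rewrite !mulrzz; apply: mulIf. Qed.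

(** Identifies C with the kernel of [Cproj m] when m > 0. *)
Definition Cmul (m : nat) (a : Cinf) : Cinf := ((a : int) *~ m)%R.

Lemma Cmul_morph (m : nat) : monoid.monoid_morphism (Cmul m).
Proof. by split=> [|a b]; [apply: mul0rz | apply: mulrzDl]. Qed.

HB.instance Definition _ m :=
  isUMagmaMorphism.Build Cinf Cinf (Cmul m) (@Cmul_morph m).

(** Sends the generator to [dT ^+ m], which generates the kernel of [Dproj m] when m > 0. *)
Definition Dmul (m : nat) (a : Cinf) : Dinf := (Cmul m a, false).

Lemma Dmul_morph (m : nat) : monoid.monoid_morphism (Dmul m).
Proof. by split=> [|a b]; rewrite /Dmul ?gmulf1 ?gmulfM. Qed.

HB.instance Definition _ m :=
  isUMagmaMorphism.Build Cinf Dinf (Dmul m) (@Dmul_morph m).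

Lemma Dmul_inj (m : nat) : 0 < m -> injective (Dmul m).
Proof. by move=> m_gt0 a b [] /mulrz_nat_inj; apply. Qed.

Lemma Cproj_ker (m : nat) (x : Cinf) : 0 < m ->
  Cproj m x = 1 <-> exists a, Cmul m a = x.
Proof. exact: Zmod_eq0. Qed.

Lemma Dproj_ker (m : nat) (x : Dinf) : 0 < m ->
  Dproj m x = 1 <-> exists a, Dmul m a = x.
Proof.
case: x => n b m_gt0; split=> [[/(Zmod_eq0 _ m_gt0)[a <-] ->]|].
  by exists a.
move=> [a [<- <-]]; congr pair; apply/(Zmod_eq0 _ m_gt0).
by exists a.
Qed.

Lemma Dproj_surj (m : nat) (z : Dih m) : exists x, Dproj m x = z.
Proof.
case: z => z b; have [n nE] := Zmod_surj z.
by exists (n, b); rewrite /Dproj /= nE.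
Qed.

Lemma dtau_exp (m k : nat) : dtau m ^+ k = (Zp1 *+ k, false)%R.
Proof.
by elim: k => // k IHk; rewrite expgS IHk; congr pair; rewrite -mulrS.
Qed.

Lemma meets_reflectionsP (m : nat) (E : groupType) (f : ghom E (Dih m)) :
  meets_reflections f <-> exists e, (f e).2 = true.
Proof.
split=> [] [e fe]; exists e; last first.
  by move=> k; rewrite dtau_exp => fE; rewrite fE in fe.
(* A rotation [(z, false)] is the power of [dtau m] with exponent [z]. *)
apply/negbNE/negP => fe2; case: (fe ((f e).1 : nat)).
rewrite dtau_exp Zp_mulrn; case: (f e) fe2 => z [] //= _.
by congr pair; apply: val_inj; rewrite /= modnMml mul1n modn_small.
Qed.

(** * Both equivalences; extensions give pull-backs with m the order of E *)

Theorem theorem3p4 (G : groupType) (E : finGroupType) :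
  ((exists (i : ghom Cinf G) (p : ghom G E),
      short_exact i p /\ central_image i) <->
   (exists (m : nat) (f : ghom E (Cyc m)),
      0 < m /\ isomorphic G (fibre_product (Cproj m) f)))
  /\
  ((exists (i : ghom Cinf G) (p : ghom G E),
      short_exact i p /\ ~ central_image i) <->
   (exists (m : nat) (f : ghom E (Dih m)),
      [/\ 0 < m,
          meets_reflections f &
          isomorphic G (fibre_product (Dproj m) f)])).
Proof.
have m_gt0 : 0 < #|E| by apply/card_gt0P; exists 1.
split; split.
- move=> [i [p [ip ci]]].
  (* Centrality makes the sign trivial, so the transfer is a homomorphism to [Cinf]. *)
  have [eps [epsP _ /proj1/(_ ci) eps0]] := kernel_conj_sign ip.
  have [r [rM ri]] := twisted_transfer ip epsP.
  have rhoM : monoid.monoid_morphism (r : G -> Cinf).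
    split=> [|g h]; last by rewrite rM eps0.
    by rewrite -(@gmulf1 _ _ i) ri mul0rz.
  pose rhoH := isUMagmaMorphism.Build G Cinf r rhoM.
  pose rho : ghom G Cinf := HB.pack (r : G -> Cinf) rhoH.
  have [f [_ iso]] := @fibre_product_of_extension _ _ _ _ _
    (Cmul #|E|) (Cproj #|E|) (mulrz_nat_inj m_gt0) (fun x => Cproj_ker x m_gt0)
    i p rho ip ri.
  by exists #|E|, f.
- move=> [m [f [m0 iso]]].
  have [i [p [ip /proj2 ci]]] := @extension_of_fibre_product _ _ _ _ _
    (Cmul m) (Cproj m) (mulrz_nat_inj m0) (fun x => Cproj_ker x m0)
    f (@Zmod_surj m) iso.
  exists i, p; split=> //; apply: ci => a x _ _; exact: addrC.
- move=> [i [p [ip nci]]]; have [eps [epsP epsM ci]] := kernel_conj_sign ip.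
  have [r [rM ri]] := twisted_transfer ip epsP.
  (* The kernel is abelian, so the sign vanishes on it. *)
  have eps_i a : eps (i a) = false.
    have [i_inj _ _] := ip; have := epsP (i a) 1%R.
    have -> : i a * i 1%R = i 1%R * i a.
      by rewrite -!gmulfM; congr (i _); apply: addrC.
    by move/mulIg/i_inj; case: (eps _).
  (* [rM] and [epsM] together are the multiplication rule of [Dinf]. *)
  have rhoM : monoid.monoid_morphism (fun g => (r g, eps g) : Dinf).
    split=> [|g h]; last by rewrite rM epsM.
    by rewrite -(@gmulf1 _ _ i) ri eps_i mul0rz.
  pose rhoH := isUMagmaMorphism.Build G Dinf _ rhoM.
  pose rho : ghom G Dinf := HB.pack (fun g => (r g, eps g) : Dinf) rhoH.
  have rho_i a : rho (i a) = Dmul #|E| a by rewrite /= ri eps_i.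
  have [f [fp iso]] := @fibre_product_of_extension _ _ _ _ _
    (Dmul #|E|) (Dproj #|E|) (Dmul_inj m_gt0) (fun x => Dproj_ker x m_gt0)
    i p rho ip rho_i.
  exists #|E|, f; split=> //; apply/meets_reflectionsP.
  (* If [f] met no reflection, all signs would vanish and the extension would be central. *)
  have feps g : (f (p g)).2 = eps g by rewrite fp.
  case: (boolP [exists e, (f e).2]) => [/existsP[e fe]|]; first by exists e.
  rewrite negb_exists => /forallP no_refl; case: nci; apply/ci => g.
  by rewrite -feps; apply/negbTE.
- move=> [m [f [m0 /meets_reflectionsP[e fe] iso]]].
  have [i [p [ip ci]]] := @extension_of_fibre_product _ _ _ _ _
    (Dmul m) (Dproj m) (Dmul_inj m0) (fun x => Dproj_ker x m0)
    f (@Dproj_surj m) iso.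
  exists i, p; split=> // /(proj1 ci) cj.
  (* [x] is a reflection, as it lies over [f e]; if it commuted with [dT ^+ m], then m = -m in
     [int], against m > 0. *)
  have [x xe] := Dproj_surj (f e); have := congr1 fst (cj 1%R x e xe).
  move: fe; rewrite -xe; case: x {xe} => n [] //= _.
  rewrite /Cmul mulrzz mul1r addrC => /addrI.
  by case: m m0 {f iso i p ip ci cj}.
Qed.
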